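(* Let $\nabla$ be a flat torsion-free linear connection on $\mathbb{R}^n$ ($n\ge 2$) and let $x_1,\dots,x_n$ be coordinates in which all Christoffel symbols of $\nabla$ vanish. Suppose that a $d$-web of hypersurfaces, $d\geq n+1$, is given locally by web functions $f_\alpha(x_1,\dots,x_n)$, $\alpha=1,\dots,d$. Then the web is hyperplanar if and only if every web function $f=f_\alpha$, $\alpha=1,\dots,d$, satisfies the PDE system $$(\operatorname{Flex} f)_{st}=0\qquad\text{for all } 1\le s<t\le n.$$
   Context: For a smooth function $f$, with $f_i=\partial f/\partial x_i$ and $f_{ij}=\partial^2f/\partial x_i\partial x_j$, $$(\operatorname{Flex} f)_{ij}=f_j^2f_{ii}-2f_if_jf_{ij}+f_i^2f_{jj}.$$ A $d$-web of hypersurfaces is given locally by $d$ foliations in general position, the $\alpha$-th foliation consisting of the level sets of a smooth function $f_\alpha$ (a web function) with nowhere vanishing differential. The web is hyperplanar if the leaves of all its foliations are totally geodesic for $\nabla$, i.e. are (open pieces of) hyperplanes in the coordinates $x_1,\dots,x_n$. *)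

(* Defs.v *)
From HB Require Import structures.
From mathcomp Require Import all_boot all_order all_algebra.
From mathcomp Require Import all_classical all_reals all_analysis.
Set Implicit Arguments.
Unset Strict Implicit.
Unset Printing Implicit Defensive.
Import Order.TTheory GRing.Theory Num.Theory.
Import numFieldNormedType.Exports.
Local Open Scope classical_set_scope.
Local Open Scope ring_scope.

(* Points of R^n are row vectors of their coordinates x_1, ..., x_n. *)

Definition partial (R : realType) (n : nat) (i : 'I_n) (f : 'rV[R]_n -> R) :
    'rV[R]_n -> R :=
  fun p => 'D_(delta_mx 0 i : 'rV[R]_n) f p.

(* On an open set this is C^infinity: every iterated partial derivative of f is
   (Frechet) differentiable, hence also continuous. *)
Definition smooth_on (R : realType) (n : nat) (U : set 'rV[R]_n)
    (f : 'rV[R]_n -> R) : Prop :=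
  forall (s : seq 'I_n) (p : 'rV[R]_n), U p ->
    differentiable (foldr (@partial R n) f s) p.

Definition gradient (R : realType) (n : nat) (f : 'rV[R]_n -> R)
    (p : 'rV[R]_n) : 'rV[R]_n :=
  \row_i partial i f p.

Definition Flex (R : realType) (n : nat) (f : 'rV[R]_n -> R) (i j : 'I_n)
    (p : 'rV[R]_n) : R :=
  partial j f p ^+ 2 * partial i (partial i f) p
  - 2 * partial i f p * partial j f p * partial i (partial j f) p
  + partial i f p ^+ 2 * partial j (partial j f) p.

Definition smooth_field (R : realType) (n : nat) (U : set 'rV[R]_n)
    (X : 'rV[R]_n -> 'rV[R]_n) : Prop :=
  forall i : 'I_n, smooth_on U (fun p => X p 0 i).

(* Vector fields on the open set U are represented by total functions whose
   values outside U are irrelevant: since functions smooth on U are arbitrary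
   off U, the axioms below force the values of nabla X Y on U to depend only on
   the restrictions of X and Y to U. *)
Record linear_connection (R : realType) (n : nat) (U : set 'rV[R]_n) :=
  LinearConnection {
  nabla :> ('rV[R]_n -> 'rV[R]_n) -> ('rV[R]_n -> 'rV[R]_n) ->
           'rV[R]_n -> 'rV[R]_n;
  nabla_smooth : forall X Y, smooth_field U X -> smooth_field U Y ->
    smooth_field U (nabla X Y);
  nabla_addl : forall X X' Y, smooth_field U X -> smooth_field U X' ->
    smooth_field U Y -> forall p, U p ->
    nabla (fun q => X q + X' q) Y p = nabla X Y p + nabla X' Y p;
  nabla_scalel : forall h X Y, smooth_on U h -> smooth_field U X ->
    smooth_field U Y -> forall p, U p ->
    nabla (fun q => h q *: X q) Y p = h p *: nabla X Y p;
  nabla_addr : forall X Y Y', smooth_field U X -> smooth_field U Y ->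
    smooth_field U Y' -> forall p, U p ->
    nabla X (fun q => Y q + Y' q) p = nabla X Y p + nabla X Y' p;
  nabla_leibniz : forall h X Y, smooth_on U h -> smooth_field U X ->
    smooth_field U Y -> forall p, U p ->
    nabla X (fun q => h q *: Y q) p = 'D_(X p) h p *: Y p + h p *: nabla X Y p
}.

Definition lie_bracket (R : realType) (n : nat) (X Y : 'rV[R]_n -> 'rV[R]_n) :
    'rV[R]_n -> 'rV[R]_n :=
  fun p => 'D_(X p) Y p - 'D_(Y p) X p.

Definition torsion_free (R : realType) (n : nat) (U : set 'rV[R]_n)
    (nab : linear_connection U) : Prop :=
  forall X Y, smooth_field U X -> smooth_field U Y -> forall p, U p ->
    nab X Y p - nab Y X p = lie_bracket X Y p.

Definition flat (R : realType) (n : nat) (U : set 'rV[R]_n)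
    (nab : linear_connection U) : Prop :=
  forall X Y Z, smooth_field U X -> smooth_field U Y -> smooth_field U Z ->
    forall p, U p ->
    nab X (nab Y Z) p - nab Y (nab X Z) p - nab (lie_bracket X Y) Z p = 0.

(* Gamma^k_ij: the k-th component of the derivative of d/dx_j along d/dx_i. *)
Definition christoffel (R : realType) (n : nat) (U : set 'rV[R]_n)
    (nab : linear_connection U) (k i j : 'I_n) (p : 'rV[R]_n) : R :=
  nab (fun=> delta_mx 0 i) (fun=> delta_mx 0 j) p 0 k.

Definition geodesic (R : realType) (n : nat) (U : set 'rV[R]_n)
    (nab : linear_connection U) (a b : R) (c : R -> 'rV[R]_n) : Prop :=
  forall t, a < t < b ->
    [/\ U (c t), derivable c t 1, derivable (derive1 c) t 1 &
        forall k : 'I_n,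
          derive1 (derive1 c) t 0 k
          + \sum_i \sum_j christoffel nab k i j (c t)
                           * derive1 c t 0 i * derive1 c t 0 j = 0].

Definition in_general_position (R : realType) (n d : nat) (D : set 'rV[R]_n)
    (f : 'I_d -> 'rV[R]_n -> R) : Prop :=
  forall p, D p -> forall s : 'I_n -> 'I_d, injective s ->
    row_free (\matrix_(k < n) gradient (f (s k)) p).

Definition is_web (R : realType) (n d : nat) (D : set 'rV[R]_n)
    (f : 'I_d -> 'rV[R]_n -> R) : Prop :=
  [/\ forall alpha, smooth_on D (f alpha),
      forall alpha p, D p -> gradient (f alpha) p != 0 &
      in_general_position D f].

(* Level sets in D need not be connected; leaves are their components. *)
Definition leaf (R : realType) (n : nat) (D : set 'rV[R]_n)
    (f : 'rV[R]_n -> R) (p : 'rV[R]_n) : set 'rV[R]_n :=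
  connected_component [set x | D x /\ f x = f p] p.

(* A geodesic that is tangent at time t0 to the leaf L of the foliation
   f = const (so that its velocity lies in the kernel of df) stays in L for
   times near t0. *)
Definition totally_geodesic (R : realType) (n : nat) (U : set 'rV[R]_n)
    (nab : linear_connection U) (f : 'rV[R]_n -> R) (L : set 'rV[R]_n) : Prop :=
  forall (a b t0 : R) (c : R -> 'rV[R]_n), a < t0 < b ->
    geodesic nab a b c -> L (c t0) ->
    'D_(derive1 c t0) f (c t0) = 0 ->
    \forall t \near t0, L (c t).

Definition hyperplanar (R : realType) (n d : nat) (U : set 'rV[R]_n)
    (nab : linear_connection U) (D : set 'rV[R]_n)
    (f : 'I_d -> 'rV[R]_n -> R) : Prop :=
  forall (alpha : 'I_d) (p : 'rV[R]_n), D p ->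
    totally_geodesic nab (f alpha) (leaf D (f alpha) p).

Definition open_piece_of_hyperplane (R : realType) (n : nat)
    (L : set 'rV[R]_n) : Prop :=
  exists (a : 'rV[R]_n) (b : R) (V : set 'rV[R]_n),
    [/\ a != 0, open V & L = [set x : 'rV[R]_n | \sum_i a 0 i * x 0 i = b] `&` V].

(* Main.v *)
Require Import Defs.
From mathcomp Require Import all_boot all_order all_algebra.
From mathcomp Require Import all_classical all_reals all_analysis.
From mathcomp Require Import ring lra.
Import Order.TTheory GRing.Theory Num.Theory.
Import numFieldNormedType.Exports.
Set Implicit Arguments.
Unset Strict Implicit.
Local Open Scope classical_set_scope.
Local Open Scope ring_scope.

(* In flat coordinates geodesics are affine lines.  If the leaves are totally
   geodesic, f is constant along lines tangent to them, so Hess f vanishes on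
   ker df, in particular on f_t e_s - f_s e_t, where its value is (Flex f)_st.
   Conversely, if Flex f vanishes then Hess f vanishes on ker df (at points where
   some f_s is 0 this uses that Flex f vanishes on a whole neighbourhood).  Hence
   u(t) = df(v) along q + t v satisfies u' = K u with K bounded, and u(0) = 0
   forces u = 0: near q the level set of f is its tangent hyperplane at q.  The
   tangent hyperplane is therefore locally constant along a leaf, so constant by
   connectedness, and the leaf is relatively open in it.  Finally a line tangent
   at one point to a piece of hyperplane stays in that hyperplane. *)

(** * Calculus along lines and symmetry of second derivatives *)

Lemma is_derive_line (R : realType) (n : nat) (g : 'rV[R]_n -> R)
    (q v : 'rV[R]_n) (t : R) : derivable g (q + t *: v) v ->
  is_derive t 1 (fun s : R => g (q + s *: v)) ('D_v g (q + t *: v)).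
Proof.
(* The two difference quotients are the same function of [h], so existence and value of the
   derivative transfer together; no differentiability of [g] beyond the direction [v] is used. *)
have E : (fun h : R => h^-1 *: (((fun s : R => g (q + s *: v)) \o shift t) (h *: (1 : R))
      - g (q + t *: v))) =
    (fun h : R => h^-1 *: ((g \o shift (q + t *: v)) (h *: v) - g (q + t *: v))).
  apply/funext => h /=; congr (_ *: (g _ - _)).
  by rewrite [h%:A]mulr1 scalerDl addrCA.
move=> gv; split; last by rewrite /derive E.
by rewrite /derivable E.
Qed.

Lemma is_derive_translate (R : realType) (n : nat) (g : 'rV[R]_n -> R)
    (x k v : 'rV[R]_n) : derivable g (x + k) v ->
  is_derive x v (fun y => g (y + k)) ('D_v g (x + k)).
Proof.
have E : (fun h : R => h^-1 *: (((fun y => g (y + k)) \o shift x) (h *: v)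
      - g (x + k))) =
    (fun h : R => h^-1 *: ((g \o shift (x + k)) (h *: v) - g (x + k))).
  by apply/funext => h /=; rewrite addrA.
move=> gv; split; last by rewrite /derive E.
by rewrite /derivable E.
Qed.

Lemma MVT_line (R : realType) (n : nat) (g : 'rV[R]_n -> R) (q v : 'rV[R]_n) :
  (forall t : R, 0 <= t <= 1 -> derivable g (q + t *: v) v) ->
  exists2 t : R, 0 <= t <= 1 & g (q + v) - g q = 'D_v g (q + t *: v).
Proof.
move=> dg.
have dl (t : R) : 0 <= t <= 1 ->
    is_derive t 1 (fun s : R => g (q + s *: v)) ('D_v g (q + t *: v)).
  by move=> /dg; exact: is_derive_line.
have [||c cI] := @MVT_segment R (fun s : R => g (q + s *: v))
    (fun t => 'D_v g (q + t *: v)) 0 1 ler01.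
- by move=> t /[!in_itv]/= /andP[t0 t1]; apply: dl; rewrite !ltW.
- apply: derivable_within_continuous => t /[!in_itv]/= /dl tI.
  exact: ex_derive.
- rewrite scale1r scale0r addr0 subr0 mulr1 => E.
  by exists c => //; move: cI; rewrite in_itv.
Qed.

Lemma partialE (R : realType) (n : nat) (g : 'rV[R]_n -> R) (p v : 'rV[R]_n) :
  differentiable g p -> 'D_v g p = \sum_i v 0 i * partial i g p.
Proof.
move=> dg; rewrite deriveE// {1}(row_sum_delta v) raddf_sum.
by apply: eq_bigr => i _; rewrite [LHS]linearZ/= /partial deriveE.
Qed.

Lemma derive_scale_delta (R : realType) (n : nat) (g : 'rV[R]_n -> R)
    (p : 'rV[R]_n) (i : 'I_n) (h : R) :
  differentiable g p -> 'D_(h *: delta_mx 0 i) g p = h * partial i g p.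
Proof. by move=> dg; rewrite /partial !deriveE// [LHS]linearZ. Qed.

Lemma norm_delta_le1 (R : realType) (n : nat) (i : 'I_n) :
  `|delta_mx 0 i : 'rV[R]_n| <= 1.
Proof.
rewrite /Num.Def.normr/= mx_normrE; apply: bigmax_le => // -[j k] _.
by rewrite mxE/=; case: (_ && _); rewrite ?normr1 ?normr0.
Qed.

Lemma smooth_on_partial (R : realType) (n : nat) (D : set 'rV[R]_n)
    (f : 'rV[R]_n -> R) (i : 'I_n) :
  smooth_on D f -> smooth_on D (partial i f).
Proof. by move=> fD s p Dp; rewrite -(foldr_rcons _ _ s i); exact: fD. Qed.

Lemma smooth_on_differentiable (R : realType) (n : nat) (D : set 'rV[R]_n)
    (f : 'rV[R]_n -> R) (p : 'rV[R]_n) :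
  smooth_on D f -> D p -> differentiable f p.
Proof. by move=> /(_ [::] p). Qed.

Lemma smooth_on_continuous (R : realType) (n : nat) (D : set 'rV[R]_n)
    (f : 'rV[R]_n -> R) (p : 'rV[R]_n) :
  smooth_on D f -> D p -> {for p, continuous f}.
Proof. by move=> fD /(smooth_on_differentiable fD)/differentiable_continuous. Qed.

(** The mean value theorem is applied twice: to [x |-> f (x + h e_j) - f x] along [h e_i], then to
    [partial i f] along [h e_j]. The condition [h + h < r] keeps the whole square spanned by the two
    steps in the ball. *)
Lemma second_difference (R : realType) (n : nat) (f : 'rV[R]_n -> R)
    (p : 'rV[R]_n) (i j : 'I_n) (r h : R) :
  smooth_on (ball p r) f -> 0 < h -> h + h < r ->
  exists2 x, ball p r x &
    f (p + h *: delta_mx 0 i + h *: delta_mx 0 j) - f (p + h *: delta_mx 0 i)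
      - (f (p + h *: delta_mx 0 j) - f p) = h * (h * partial j (partial i f) x).
Proof.
move=> fS h0 hr.
set ei : 'rV[R]_n := delta_mx 0 i; set ej : 'rV[R]_n := delta_mx 0 j.
have inb (s t : R) : 0 <= s <= 1 -> 0 <= t <= 1 ->
    ball p r (p + s *: (h *: ei) + t *: (h *: ej)).
  move=> /andP[s0 s1] /andP[t0 t1]; rewrite -ball_normE/= -addrA opprD addrA subrr.
  rewrite add0r normrN (le_lt_trans (ler_normD _ _))// (le_lt_trans _ hr)//.
  rewrite !normrZ !(ger0_norm s0, ger0_norm t0, gtr0_norm h0).
  have := @norm_delta_le1 R n i; have := @norm_delta_le1 R n j.
  rewrite -/ei -/ej => ej1 ei1.
  have b (u x : R) : 0 <= u -> u <= 1 -> 0 <= x -> x <= 1 -> u * (h * x) <= h.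
    by move=> u0 u1 x0 x1; rewrite mulrCA ler_piMr ?mulr_ile1// ltW.
  by rewrite lerD// b.
have dS g s t : smooth_on (ball p r) g -> 0 <= s <= 1 -> 0 <= t <= 1 ->
    differentiable g (p + s *: (h *: ei) + t *: (h *: ej)).
  by move=> gS s01 t01; apply: smooth_on_differentiable gS _; exact: inb.
have z01 : 0 <= (0 : R) <= 1 by rewrite lexx ler01.
have o01 : 0 <= (1 : R) <= 1 by rewrite lexx ler01.
pose G x := f (x + h *: ej) - f x.
have dfj s : 0 <= s <= 1 -> is_derive (p + s *: (h *: ei)) (h *: ei)
    (fun x => f (x + h *: ej))
    ('D_(h *: ei) f (p + s *: (h *: ei) + h *: ej)).
  move=> s01; have := dS f s 1 fS s01 o01; rewrite scale1r => df.
  by apply: is_derive_translate; exact: diff_derivable.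
have dG s : 0 <= s <= 1 -> is_derive (p + s *: (h *: ei)) (h *: ei) G
   (h * (partial i f (p + s *: (h *: ei) + h *: ej)
         - partial i f (p + s *: (h *: ei)))).
  move=> s01; rewrite mulrBr -!derive_scale_delta.
  - have := dS f s 0 fS s01 z01; rewrite scale0r addr0 => df.
    have := dfj _ s01 => dfj1.
    by apply: is_deriveB; apply: derivableP; exact: diff_derivable.
  - by have := dS f s 0 fS s01 z01; rewrite scale0r addr0.
  - by have := dS f s 1 fS s01 o01; rewrite scale1r.
have [s s01 Es] := @MVT_line R n G p (h *: ei)
  (fun s s01 => @ex_derive _ _ _ _ _ _ _ (dG s s01)).
have fiS := smooth_on_partial i fS.
have [t' t'01|t t01 Et] :=
  @MVT_line R n (partial i f) (p + s *: (h *: ei)) (h *: ej).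
  by apply: diff_derivable; exact: dS.
exists (p + s *: (h *: ei) + t *: (h *: ej)); first exact: inb.
have := dG s s01 => dGs.
rewrite -derive_scale_delta; last exact: dS.
by rewrite -Et -(@derive_val _ _ _ _ _ _ _ dGs) -Es /G.
Qed.

(** The second difference is symmetric in [i] and [j], so the two mixed derivatives agree at points
    [x] and [y] arbitrarily close to [p]; continuity of both at [p] then forces equality there. *)
Lemma partialC (R : realType) (n : nat) (D : set 'rV[R]_n)
    (f : 'rV[R]_n -> R) (p : 'rV[R]_n) (i j : 'I_n) :
  open D -> smooth_on D f -> D p ->
  partial i (partial j f) p = partial j (partial i f) p.
Proof.
move=> oD fS Dp; apply/eqP; rewrite -subr_eq0 -normr_le0.
apply/ler_addgt0Pr => e e0; rewrite add0r.
have e2 : 0 < e / 2 by rewrite divr_gt0.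
have cont k l : \forall x \near p,
    `|partial k (partial l f) p - partial k (partial l f) x| < e / 2.
  have := smooth_on_continuous (smooth_on_partial k (smooth_on_partial l fS)) Dp.
  by move=> /cvgrPdist_lt/(_ _ e2).
have /nbhs_ballP[r /= r0 rP] : \forall x \near p, [/\ D x,
    `|partial i (partial j f) p - partial i (partial j f) x| < e / 2 &
    `|partial j (partial i f) p - partial j (partial i f) x| < e / 2].
  by apply: filterS3 (cont i j) (cont j i) (open_nbhs_nbhs (conj oD Dp)).
have rS : smooth_on (ball p r) f by move=> s x /rP[Dx _ _]; exact: fS.
have h0 : 0 < r / 3 by rewrite divr_gt0.
have hr : r / 3 + r / 3 < r by lra.
have [x xr Ex] := second_difference i j rS h0 hr.
have [y yr Ey] := second_difference j i rS h0 hr.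
have Exy : partial j (partial i f) x = partial i (partial j f) y.
  have h'0 : r / 3 != 0 by rewrite gt_eqF.
  apply: (mulfI h'0); apply: (mulfI h'0).
  apply: etrans (esym Ex) _; apply: etrans _ Ey.
  by rewrite (addrAC p); ring.
have [_ _ xe] := rP _ xr; have [_ ye _] := rP _ yr.
rewrite Exy in xe; move: xe ye.
move: (partial i (partial j f) p) (partial j (partial i f) p)
  (partial i (partial j f) y) => a b c.
rewrite ler_norml !ltr_norml => /andP[? ?] /andP[? ?].
by clear Ex Ey Exy rP cont; apply/andP; split; lra.
Qed.

(** The nonnegative function [u ^+ 2 * expR (- (2 * C) * s)] is nonincreasing, because its
    derivative is a positive factor times [u u' - C u^2 <= 0]. It starts at 0, so it stays 0. *)
Lemma gronwall_eq0 (R : realType) (u du : R -> R) (C : R) :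
  (forall t : R, 0 <= t <= 1 -> is_derive t 1 u (du t)) ->
  (forall t : R, 0 <= t <= 1 -> `|du t| <= C * `|u t|) ->
  u 0 = 0 -> forall t : R, 0 <= t <= 1 -> u t = 0.
Proof.
move=> duP duC u0 t /andP[t0 t1].
pose w (s : R) := u s ^+ 2 * expR (- (2 * C) * s).
pose dw (s : R) := (2 * (u s * du s) - 2 * C * u s ^+ 2) * expR (- (2 * C) * s).
have dwP (s : R) : 0 <= s <= 1 -> is_derive s 1 w (dw s).
  move=> /duP us; rewrite /w.
  have ds : is_derive s 1 (fun s : R => expR (- (2 * C) * s))
     (expR (- (2 * C) * s) * (- (2 * C))).
    apply: (@is_derive1_comp R expR (fun s => - (2 * C) * s)).
    apply: is_derive_eq; rewrite /=.
    rewrite /GRing.scale/=; ring.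
  apply: is_derive_eq; rewrite /dw /GRing.scale/=; ring.
have w01 (s : R) : s \in `]0, 1[ -> 0 <= s <= 1.
  by rewrite in_itv/= => /andP[s0 s1]; rewrite !ltW.
have w0 : w 0 = 0 by rewrite /w u0 expr0n/= mul0r.
have : w t <= 0.
  rewrite -{1}w0; apply: (@ler0_derive1_nincr R w 0 1) => //.
  - by move=> s /w01/dwP dws; exact: ex_derive.
  - move=> s /w01 s01; rewrite derive1E (@derive_val _ _ _ _ _ _ _ (dwP s s01)).
    rewrite /dw pmulr_lle0 ?expR_gt0// subr_le0 -mulrA ler_pM2l//.
    rewrite (le_trans (ler_norm _))// normrM -[u s ^+ 2]real_normK ?num_real//.
    by rewrite expr2 mulrCA ler_wpM2l// duC.
  - apply: derivable_within_continuous => s; rewrite in_itv/= => /dwP dws.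
    exact: ex_derive.
rewrite /w pmulr_lle0 ?expR_gt0// => ut.
by apply/eqP; rewrite -sqrf_eq0 eq_le ut sqr_ge0.
Qed.

(** * Vanishing of the Hessian on the kernel of the differential *)

Lemma near_neq0 (R : realType) (n : nat) (g : 'rV[R]_n -> R) (p : 'rV[R]_n) :
  {for p, continuous g} -> g p != 0 -> \forall x \near p, g x != 0.
Proof. by move=> gc; exact: (@cvgr_neq0 _ _ _ (nbhs p) _ g (g p) gc). Qed.

Lemma near0_partial (R : realType) (n : nat) (g : 'rV[R]_n -> R) (i : 'I_n)
    (p : 'rV[R]_n) : (\forall x \near p, g x = 0) -> partial i g p = 0.
Proof.
move=> g0; rewrite /partial (@near_eq_derive _ _ _ g (cst 0))//.
exact: derive_cst.
Qed.

(* Otherwise ring and the unifier compare distinct partial derivatives by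
   unfolding them down to the limits. *)
#[local] Opaque partial.

(** [Flex] is symmetric in its indices by [partialC], and on the diagonal its three terms cancel
    identically. *)
Lemma Flex_eq0 (R : realType) (n : nat) (D : set 'rV[R]_n)
    (f : 'rV[R]_n -> R) : open D -> smooth_on D f ->
  (forall s t : 'I_n, (s < t)%N -> forall p, D p -> Flex f s t p = 0) ->
  forall (s t : 'I_n) p, D p -> Flex f s t p = 0.
Proof.
move=> oD fS F0 s t p Dp; have [st|ts|/val_inj ->] := ltngtP s t.
- exact: F0.
- transitivity (Flex f t s p); last exact: F0.
  have := partialC s t oD fS Dp; rewrite /Flex.
  by move: (@partial R n) => d ->; ring.
- by rewrite /Flex; move: (@partial R n) => d; ring.
Qed.

(* With w_s = f_i e_s - f_s e_i in ker df, this is (Hess f)(w_s, w_t). *)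
Definition polar (R : realType) (n : nat) (f : 'rV[R]_n -> R) (i s t : 'I_n)
    (p : 'rV[R]_n) : R :=
  partial i f p * partial i f p * partial s (partial t f) p
  - partial i f p * partial s f p * partial i (partial t f) p
  - partial i f p * partial t f p * partial i (partial s f) p
  + partial s f p * partial t f p * partial i (partial i f) p.

Lemma polarC (R : realType) (n : nat) (D : set 'rV[R]_n)
    (f : 'rV[R]_n -> R) (i s t : 'I_n) (p : 'rV[R]_n) :
  open D -> smooth_on D f -> D p -> polar f i s t p = polar f i t s p.
Proof.
move=> oD fS Dp; have := partialC s t oD fS Dp; rewrite /polar.
by move: (@partial R n) => d ->; ring.
Qed.

Lemma continuous_polar (R : realType) (n : nat) (D : set 'rV[R]_n)
    (f : 'rV[R]_n -> R) (i s t : 'I_n) (p : 'rV[R]_n) :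
  smooth_on D f -> D p -> {for p, continuous (polar f i s t)}.
Proof.
move=> fS Dp.
have c1 k : {for p, continuous (partial k f)}.
  exact: smooth_on_continuous (smooth_on_partial k fS) Dp.
have c2 k l : {for p, continuous (partial k (partial l f))}.
  exact: smooth_on_continuous (smooth_on_partial k (smooth_on_partial l fS)) Dp.
apply: continuousD; [apply: continuousB; [apply: continuousB|]|];
  apply: continuousM; try exact: c2; apply: continuousM; exact: c1.
Qed.

(** Each of the four terms of [polar] contains [partial t f] or one of its first derivatives. *)
Lemma polar_near0 (R : realType) (n : nat) (f : 'rV[R]_n -> R)
    (i s t : 'I_n) (p : 'rV[R]_n) :
  (\forall x \near p, partial t f x = 0) -> polar f i s t p = 0.
Proof.
move=> ft0; have := nbhs_singleton ft0.
have := near0_partial s ft0; have := near0_partial i ft0.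
by rewrite /polar; move: (@partial R n) => d -> -> ->; ring.
Qed.

(* Flex determines the values of Hess f on the vectors w_s, w_t and on
   f_t w_s - f_s w_t, a multiple of f_t e_s - f_s e_t; hence
   f_s f_t Hess f(w_s, w_t) = 0, and where f_s or f_t vanishes on an open set,
   so do its derivatives. *)
Lemma polar_eq0 (R : realType) (n : nat) (D : set 'rV[R]_n)
    (f : 'rV[R]_n -> R) : open D -> smooth_on D f ->
  (forall (s t : 'I_n) p, D p -> Flex f s t p = 0) ->
  forall (i s t : 'I_n) p, D p -> polar f i s t p = 0.
Proof.
move=> oD fS F0 i s t p Dp; apply: contrapT => /eqP Pp0.
have [r r0 rP] : exists2 r : R, 0 < r &
    ball p r `<=` D `&` [set x | polar f i s t x != 0].
  have /nbhs_ballP[r /= r0 rP] : \forall x \near p, D x /\ polar f i s t x != 0.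
    have P0 := near_neq0 (@continuous_polar _ _ _ _ i s t p fS Dp) Pp0.
    exact: filterS2 (open_nbhs_nbhs (conj oD Dp)) P0.
  by exists r.
have fst0 x : D x -> polar f i s t x != 0 -> partial s f x * partial t f x = 0.
  move=> Dx Px0; apply/eqP; rewrite -(mulIr_eq0 _ (mulIf Px0)).
  rewrite -(mulrI_eq0 _ (@mulfI _ 2 _)) ?pnatr_eq0//; apply/eqP.
  transitivity (partial t f x ^+ 2 * Flex f s i x
    + partial s f x ^+ 2 * Flex f t i x - partial i f x ^+ 2 * Flex f s t x).
    have := partialC s i oD fS Dx; have := partialC t i oD fS Dx.
    by rewrite /polar /Flex; move: (@partial R n) => d -> ->; ring.
  have := F0 s i x Dx; have := F0 t i x Dx; have := F0 s t x Dx.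
  by move: (Flex f) (@partial R n) => F d -> -> ->; rewrite !mulr0 addr0 subr0.
have nb x : ball p r x -> \forall y \near x, ball p r y.
  by move=> xr; apply: open_nbhs_nbhs; split => //; exact: ball_open.
(* Either [partial t f] vanishes on the ball, and [polar] vanishes at [p]; or it is nonzero at some
   [q], hence near [q]. In the second case [partial s f] vanishes near [q], and [polar], being
   symmetric, vanishes at [q]. Both contradict the choice of the ball. *)
have [ft0|/existsNP[q /not_implyP[qr /eqP ftq]]] :=
    pselect (forall x, ball p r x -> partial t f x = 0).
  move/eqP: Pp0; apply; apply: polar_near0.
  by apply: filterS (nb p (ballxx p r0)) => x /ft0.
have [Dq Pq0] := rP q qr.
move/eqP: Pq0; apply; rewrite (polarC i s t oD fS Dq); apply: polar_near0.
have nf := near_neq0 (smooth_on_continuous (smooth_on_partial t fS) Dq) ftq.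
apply: filterS2 nf (nb q qr) => x ftx xr.
have [Dx Px] := rP x xr.
by have /eqP := fst0 x Dx Px; rewrite mulf_eq0 (negbTE ftx) orbF => /eqP.
Qed.

(** * Level sets are locally hyperplanes *)

Definition dot (R : realType) (n : nat) (a x : 'rV[R]_n) : R :=
  \sum_i a 0 i * x 0 i.

Lemma dotD (R : realType) (n : nat) (a x y : 'rV[R]_n) :
  dot a (x + y) = dot a x + dot a y.
Proof. by rewrite /dot -big_split; apply: eq_bigr => i _; rewrite mxE mulrDr. Qed.

Lemma dotZ (R : realType) (n : nat) (a x : 'rV[R]_n) (k : R) :
  dot a (k *: x) = k * dot a x.
Proof. by rewrite /dot mulr_sumr; apply: eq_bigr => i _; rewrite mxE mulrCA. Qed.

Lemma dotB (R : realType) (n : nat) (a x y : 'rV[R]_n) :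
  dot a (x - y) = dot a x - dot a y.
Proof. by rewrite dotD -scaleN1r dotZ mulN1r. Qed.

Lemma dot_delta (R : realType) (n : nat) (a : 'rV[R]_n) (i : 'I_n) :
  dot a (delta_mx 0 i) = a 0 i.
Proof.
rewrite /dot (bigD1 i)//= big1 => [|j ji]; last by rewrite mxE (negbTE ji) mulr0.
by rewrite mxE !eqxx mulr1 addr0.
Qed.

Lemma derive_gradient (R : realType) (n : nat) (f : 'rV[R]_n -> R)
    (p v : 'rV[R]_n) : differentiable f p -> 'D_v f p = dot (gradient f p) v.
Proof.
by move=> df; rewrite partialE//; apply: eq_bigr => i _; rewrite mxE mulrC.
Qed.

Lemma norm_coord_le (R : realType) (n : nat) (x : 'rV[R]_n) (i : 'I_n) :
  `|x 0 i| <= `|x|.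
Proof.
rewrite [leRHS]/Num.Def.normr/= mx_normrE.
exact: (le_bigmax _ (fun ij : 'I_1 * 'I_n => `|x ij.1 ij.2|) (0, i)).
Qed.

Lemma dot_le (R : realType) (n : nat) (a x : 'rV[R]_n) :
  `|dot a x| <= `|x| * \sum_i `|a 0 i|.
Proof.
rewrite (le_trans (ler_norm_sum _ _ _))// mulr_sumr ler_sum// => i _.
by rewrite normrM mulrC ler_wpM2r// norm_coord_le.
Qed.

Lemma ball_segment (R : realType) (n : nat) (q x y : 'rV[R]_n) (r t : R) :
  ball q r x -> ball q r y -> 0 <= t <= 1 -> ball q r (x + t *: (y - x)).
Proof.
rewrite -ball_normE/= => qx qy /andP[t0 t1].
rewrite (_ : q - _ = (1 - t) *: (q - x) + t *: (q - y)); last first.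
  by rewrite scalerBl scale1r !scalerBr; apply/rowP => i; rewrite !mxE; ring.
rewrite (le_lt_trans (ler_normD _ _))// !normrZ (ger0_norm t0) ger0_norm ?subr_ge0//.
have mr : Num.max `|q - x| `|q - y| < r by rewrite gt_max qx.
rewrite (le_lt_trans _ mr)//.
rewrite [leRHS](_ : _ = (1 - t) * Num.max `|q - x| `|q - y|
  + t * Num.max `|q - x| `|q - y|); last by ring.
by rewrite lerD// ler_wpM2l ?subr_ge0// le_max lexx ?orbT.
Qed.

(* The linear form K_x such that Hess f(v, v) = df(v) K_x(v) for all v, which exists
   when Hess f vanishes on ker df. *)
Definition curvature_form (R : realType) (n : nat) (f : 'rV[R]_n -> R)
    (i : 'I_n) (x : 'rV[R]_n) : 'rV[R]_n :=
  \row_t ((2 * partial i f x * partial i (partial t f) x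
           - partial t f x * partial i (partial i f) x) / partial i f x ^+ 2).

(** The entries are quotients of continuous functions whose denominator is nonzero at [q], so near
    [q] each stays within 1 of its value there. The bound serves as the constant in
    [gronwall_eq0]. *)
Lemma curvature_form_bound (R : realType) (n : nat) (D : set 'rV[R]_n)
    (f : 'rV[R]_n -> R) (i : 'I_n) (q : 'rV[R]_n) :
  smooth_on D f -> D q -> partial i f q != 0 ->
  exists C : 'I_n -> R, \forall x \near q, forall t,
    `|curvature_form f i x 0 t| <= C t.
Proof.
move=> fS Dq fiq; exists (fun t => `|curvature_form f i q 0 t| + 1).
apply: (filter_forall (nbhs_filter q)) => t.
have c1 k : {for q, continuous (partial k f)}.
  exact: smooth_on_continuous (smooth_on_partial k fS) Dq.
have c2 k l : {for q, continuous (partial k (partial l f))}.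
  exact: smooth_on_continuous (smooth_on_partial k (smooth_on_partial l fS)) Dq.
pose g x := (2 * partial i f x * partial i (partial t f) x
  - partial t f x * partial i (partial i f) x) / partial i f x ^+ 2.
have gE x : curvature_form f i x 0 t = g x by rewrite mxE.
have : {for q, continuous g}.
  apply: continuousM.
    apply: continuousB; apply: continuousM => //.
    by apply: continuousM => //; exact: cst_continuous.
  apply: continuousV; first by rewrite sqrf_eq0.
  by apply: continuousM.
move=> /cvgrPdist_lt/(_ 1 ltr01); apply: filterS => x x1.
rewrite !gE -[g x](subrK (g q)).
by rewrite (le_trans (ler_normD _ _))// addrC lerD2l distrC ltW.
Qed.

(** The left side is Hess f(v, v). Vanishing of [polar] expresses f_i^2 f_st through f_s, f_t and
    the derivatives of f_i. Summed against v_s v_t this gives N (2 f_i M - N f_ii), where N = df(v)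
    and M is the derivative of f_i along v; the second factor is f_i^2 K(v) for the form K of
    [curvature_form]. *)
Lemma second_derivative_line (R : realType) (n : nat) (D : set 'rV[R]_n)
    (f : 'rV[R]_n -> R) (i : 'I_n) (x v : 'rV[R]_n) :
  open D -> smooth_on D f -> D x -> partial i f x != 0 ->
  (forall s t : 'I_n, polar f i s t x = 0) ->
  \sum_s v 0 s * dot (gradient (partial s f) x) v =
  dot (gradient f x) v * dot (curvature_form f i x) v.
Proof.
move=> oD fS Dx fi0 P0.
have fi2 : partial i f x ^+ 2 != 0 by rewrite sqrf_eq0.
apply: (mulfI fi2); rewrite mulr_sumr.
pose N := \sum_s v 0 s * partial s f x.
pose M := \sum_s v 0 s * partial i (partial s f) x.
transitivity (2 * partial i f x * N * M - N * N * partial i (partial i f) x).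
  transitivity (\sum_s \sum_t
      (partial i f x * (v 0 s * partial s f x) * (v 0 t * partial i (partial t f) x)
       + partial i f x * (v 0 s * partial i (partial s f) x) * (v 0 t * partial t f x)
       - (v 0 s * partial s f x) * (v 0 t * partial t f x)
         * partial i (partial i f) x)).
    apply: eq_bigr => s _; rewrite /dot !mulr_sumr; apply: eq_bigr => t _.
    have := P0 t s; rewrite /gradient mxE /polar; move: (@partial R n) => d Pd.
    apply/eqP; rewrite -subr_eq0; apply/eqP.
    rewrite -[RHS](mulr0 (v 0 s * v 0 t)) -Pd; ring.
  pose A s := v 0 s * partial s f x; pose B s := v 0 s * partial i (partial s f) x.
  transitivity (\sum_s (partial i f x * A s * M + partial i f x * B s * N
      - A s * N * partial i (partial i f) x)).
    apply: eq_bigr => s _; rewrite /M /N !mulr_sumr mulr_suml -big_split -sumrB.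
    by apply: eq_bigr.
  rewrite big_split sumrN big_split /= -!mulr_suml -!mulr_sumr.
  by rewrite -/N -/M; move: (partial i f x) (partial i (partial i f) x) => *; ring.
rewrite (_ : dot (gradient f x) v = N); last first.
  by apply: eq_bigr => s _; rewrite mxE mulrC.
rewrite mulrCA (_ : _ * dot _ v = 2 * partial i f x * M - N * partial i (partial i f) x).
  by move: (partial i f x) (partial i (partial i f) x) => *; ring.
rewrite /dot mulr_sumr /N /M mulr_sumr mulr_suml -sumrB; apply: eq_bigr => s _.
rewrite mxE mulrA mulrCA mulfV// mulr1.
by move: (@partial R n) => d; ring.
Qed.

Lemma is_derive_smooth_line (R : realType) (n : nat) (D : set 'rV[R]_n)
    (f : 'rV[R]_n -> R) (q v : 'rV[R]_n) (t : R) :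
  smooth_on D f -> D (q + t *: v) ->
  is_derive t 1 (fun s : R => f (q + s *: v)) (dot (gradient f (q + t *: v)) v).
Proof.
move=> fS Dt; have df := smooth_on_differentiable fS Dt.
by rewrite -derive_gradient//; apply: is_derive_line; exact: diff_derivable.
Qed.

Lemma is_derive_gradient_line (R : realType) (n : nat) (D : set 'rV[R]_n)
    (f : 'rV[R]_n -> R) (q v : 'rV[R]_n) (t : R) :
  smooth_on D f -> D (q + t *: v) ->
  is_derive t 1 (fun s : R => dot (gradient f (q + s *: v)) v)
    (\sum_s v 0 s * dot (gradient (partial s f) (q + t *: v)) v).
Proof.
move=> fS Dt.
have -> : (fun s : R => dot (gradient f (q + s *: v)) v) =
    \sum_(s < n) (fun t : R => v 0 s * partial s f (q + t *: v)).
  apply/funext => s; rewrite fct_sumE; apply: eq_bigr => k _.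
  by rewrite mxE mulrC.
apply: is_derive_sum => s.
have ds := is_derive_smooth_line (smooth_on_partial s fS) Dt.
exact: is_derive_eq.
Qed.

Lemma tangent_constant (R : realType) (n : nat) (D : set 'rV[R]_n)
    (f : 'rV[R]_n -> R) (i : 'I_n) (q : 'rV[R]_n) :
  open D -> smooth_on D f ->
  (forall (i s t : 'I_n) p, D p -> polar f i s t p = 0) ->
  D q -> partial i f q != 0 ->
  exists r : R, [/\ 0 < r, ball q r `<=` D,
    forall x, ball q r x -> partial i f x != 0 &
    forall x, ball q r x -> dot (gradient f q) (x - q) = 0 -> f x = f q].
Proof.
move=> oD fS P0 Dq fiq.
have [C nC] := curvature_form_bound fS Dq fiq.
have nf := near_neq0 (smooth_on_continuous (smooth_on_partial i fS) Dq) fiq.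
have /nbhs_ballP[r /= r0 rP] : \forall x \near q, [/\ D x, partial i f x != 0 &
    forall t, `|curvature_form f i x 0 t| <= C t].
  by apply: filterS3 (open_nbhs_nbhs (conj oD Dq)) nf nC.
exists r; split => // [x /rP[]//|x /rP[]//|x xr qx0].
pose v := x - q.
have line (t : R) : 0 <= t <= 1 -> ball q r (q + t *: v).
  by move=> t01; apply: ball_segment => //; exact: ballxx.
pose u (t : R) := dot (gradient f (q + t *: v)) v.
pose du (t : R) := u t * dot (curvature_form f i (q + t *: v)) v.
have dudu (t : R) : 0 <= t <= 1 -> is_derive t 1 u (du t).
  move=> t01; have [Dt fit _] := rP _ (line t t01).
  rewrite /du /u -(second_derivative_line v oD fS Dt fit); last first.
    by move=> *; exact: P0.
  exact: is_derive_gradient_line fS Dt.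
have u0 : u 0 = 0 by rewrite /u scale0r addr0.
(* Along the segment K(v) is bounded by [|v|] times the sum of the coordinate bounds, independently
   of [t]. *)
have duC (t : R) : 0 <= t <= 1 -> `|du t| <= (`|v| * \sum_s C s) * `|u t|.
  move=> /line/rP[_ _ Ct]; rewrite normrM mulrC ler_wpM2r//.
  by rewrite (le_trans (dot_le _ _))// ler_wpM2l// ler_sum.
have ut0 := gronwall_eq0 dudu duC u0.
have [t t01|t t01] := @MVT_line R n f q v.
  apply: diff_derivable; apply: smooth_on_differentiable fS _.
  by have [] := rP _ (line t t01).
have [Dt _ _] := rP _ (line t t01).
rewrite derive_gradient; last exact: smooth_on_differentiable fS Dt.
rewrite [dot _ _](ut0 t t01) /v subrKC => /eqP.
by rewrite subr_eq0 => /eqP.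
Qed.

(** One direction is [tangent_constant]. For the other, a point x of the level set is moved along
    e_i to a point y of the tangent hyperplane at q. Then f y = f q = f x, and since f_i has no zero
    on the segment from x to y, the mean value theorem gives y = x. *)
Lemma level_set_tangent (R : realType) (n : nat) (D : set 'rV[R]_n)
    (f : 'rV[R]_n -> R) (q : 'rV[R]_n) :
  open D -> smooth_on D f ->
  (forall (i s t : 'I_n) p, D p -> polar f i s t p = 0) ->
  D q -> gradient f q != 0 ->
  exists r : R, [/\ 0 < r, ball q r `<=` D &
    forall x, ball q r x -> f x = f q <-> dot (gradient f q) (x - q) = 0].
Proof.
move=> oD fS P0 Dq gq0.
have [i fiq] : exists i, partial i f q != 0.
  apply: contrapT => /forallNP gE; move/eqP: gq0; apply.
  by apply/rowP => i; rewrite !mxE; apply/eqP; move: (gE i) => /negP; rewrite negbK.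
have [r [r0 rD fir rT]] := tangent_constant oD fS P0 Dq fiq.
set a := gradient f q in rT *.
have ai : a 0 i = partial i f q by rewrite mxE.
pose M := (\sum_j `|a 0 j|) / `|partial i f q|.
have M0 : 0 <= M by rewrite divr_ge0// sumr_ge0.
have M1 : 0 < 1 + M by rewrite ltr_pwDl.
(* The displacement [tau] below has size at most [|q - x| * M], so y is at distance at most
   [|q - x| * (1 + M)] from q; this radius keeps y in [ball q r]. *)
pose r' := r / (1 + M).
have r'0 : 0 < r' by rewrite divr_gt0.
have r'r : r' <= r by rewrite ler_pdivrMr// ler_peMr ?lerDl// ltW.
have sub : ball q r' `<=` ball q r by exact: le_ball.
exists r'; split => // [x /sub/rD//|x xr']; split; last by move: (sub x xr'); exact: rT.
move=> fx; pose tau := - (dot a (x - q) / partial i f q).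
pose y := x + tau *: (delta_mx 0 i : 'rV[R]_n).
have yq : dot a (y - q) = 0.
  rewrite /y addrAC dotD dotZ dot_delta ai /tau mulNr divfK ?subrr//.
have yr : ball q r y.
  move: xr'; rewrite -ball_normE/= => xr'.
  rewrite /y opprD addrA (le_lt_trans (ler_normB _ _))//.
  have ty : `|tau| <= `|q - x| * M.
    rewrite /tau normrN normrM normfV /M mulrA ler_wpM2r// distrC.
    exact: dot_le.
  rewrite normrZ (@le_lt_trans _ _ (`|q - x| * (1 + M)))//; last by rewrite -ltr_pdivlMr.
  rewrite mulrDr mulr1 lerD2l (le_trans _ ty)// ler_piMr//.
  exact: norm_delta_le1.
have fy := rT y yr yq.
have yx : y - x = tau *: delta_mx 0 i by rewrite /y addrC addKr.
have line (t : R) : 0 <= t <= 1 -> ball q r (x + t *: (y - x)).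
  by apply: ball_segment => //; exact: sub.
have dline (t : R) : 0 <= t <= 1 -> differentiable f (x + t *: (y - x)).
  by move=> /line/rD; exact: smooth_on_differentiable.
have [t t01|t t01] := @MVT_line R n f x (y - x).
  by apply: diff_derivable; exact: dline.
rewrite subrKC fx fy subrr derive_gradient; last exact: dline.
rewrite {2}yx dotZ dot_delta mxE => /esym/eqP.
rewrite mulf_eq0 (negbTE (fir _ (line t t01))) orbF => /eqP tau0.
by rewrite -yq /y tau0 scale0r addr0.
Qed.

(** * Leaves *)

Definition tangent (R : realType) (n : nat) (f : 'rV[R]_n -> R)
    (q : 'rV[R]_n) : set 'rV[R]_n :=
  [set x | dot (gradient f q) (x - q) = 0].

Lemma near_segment (R : realType) (n : nat) (x v : 'rV[R]_n) (r : R) :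
  0 < r -> exists2 e : R, 0 < e & ball x r (x + e *: v).
Proof.
move=> r0; have v1 : 0 < 1 + `|v| by rewrite ltr_pwDl.
exists (r / (1 + `|v|)); first by rewrite divr_gt0.
rewrite -ball_normE/= opprD addrA subrr add0r normrN normrZ.
rewrite ger0_norm ?divr_ge0 ?ltW// mulrAC ltr_pdivrMr// ltr_pM2l//.
by rewrite ltrDr.
Qed.

(** In a small ball around x both hyperplanes coincide with the same level set. Both contain x, so
    membership of any z is unchanged by contracting z towards x into that ball. *)
Lemma tangent_locally_constant (R : realType) (n : nat) (f : 'rV[R]_n -> R)
    (q x : 'rV[R]_n) (r r' : R) : 0 < r' -> ball q r x -> f x = f q ->
  (forall y, ball q r y -> f y = f q <-> tangent f q y) ->
  (forall y, ball x r' y -> f y = f x <-> tangent f x y) ->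
  tangent f x = tangent f q.
Proof.
move=> r'0 xr fxq Tq Tx; apply/seteqP.
have [d d0 dr] : exists2 d : R, 0 < d & ball x d `<=` ball q r `&` ball x r'.
  have /nbhs_ballP[d /= d0 dr] : nbhs x (ball q r `&` ball x r').
    apply: open_nbhs_nbhs; split; first by apply: openI; exact: ball_open.
    by split => //; exact: ballxx.
  by exists d.
have qx : dot (gradient f q) (x - q) = 0 by apply/Tq.
suff E z : tangent f x z <-> tangent f q z by split => z /E.
have [e e0 ye] := near_segment x (z - x) d0.
have [yq yx] := dr _ ye.
have e0' : e != 0 by rewrite gt_eqF.
have -> : tangent f x z <-> tangent f x (x + e *: (z - x)).
  rewrite /tangent /= [x + _]addrC addrK dotZ; split => [->|/eqP]; first by rewrite mulr0.
  by rewrite mulf_eq0 (negbTE e0') => /eqP.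
have -> : tangent f q z <-> tangent f q (x + e *: (z - x)).
  rewrite /tangent /= [x + _ - q]addrAC (dotD _ (x - q)) qx add0r dotZ.
  rewrite -(subrKA x z) (dotD _ (z - x)) qx addr0.
  split => [->|/eqP]; first by rewrite mulr0.
  by rewrite mulf_eq0 (negbTE e0') => /eqP.
by rewrite -(Tx _ yx) -(Tq _ yq) fxq.
Qed.

Lemma segment_component (R : realType) (n : nat) (S : set 'rV[R]_n)
    (x y : 'rV[R]_n) :
  (forall t : R, 0 <= t <= 1 -> S (x + t *: (y - x))) ->
  connected_component S x y.
Proof.
move=> sub.
pose g (t : R) := x + t *: (y - x).
exists (g @` `[0, 1]); last first.
  by exists 1; [rewrite /= in_itv/= lexx ler01|rewrite /g scale1r subrKC].
split.
- by exists 0; [rewrite /= in_itv/= lexx ler01|rewrite /g scale0r addr0].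
- by move=> _ [t + <-] => /=; rewrite in_itv/=; exact: sub.
- apply: connected_continuous_connected; first exact: segment_connected.
  apply: continuous_subspaceT => t.
  apply: (@continuousD R _ _ (cst x) (fun s : R => s *: (y - x)) t).
    exact: cst_continuous.
  exact: scalel_continuous.
Qed.

Lemma leaf_open_piece (R : realType) (n : nat) (D : set 'rV[R]_n)
    (f : 'rV[R]_n -> R) (p : 'rV[R]_n) :
  open D -> smooth_on D f ->
  (forall (i s t : 'I_n) p, D p -> polar f i s t p = 0) ->
  (forall q, D q -> gradient f q != 0) ->
  D p -> open_piece_of_hyperplane (leaf D f p).
Proof.
move=> oD fS P0 g0 Dp.
pose L := leaf D f p.
have LS q : L q -> D q /\ f q = f p by move/connected_component_sub.
have Lp : L p by apply: connected_component_refl.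
pose good (z : 'rV[R]_n * R) := [/\ 0 < z.2, ball z.1 z.2 `<=` D &
  forall y, ball z.1 z.2 y -> f y = f z.1 <-> tangent f z.1 y].
have goodP q : L q -> exists r, good (q, r).
  by move=> /LS[Dq _]; exact: level_set_tangent (g0 _ Dq).
have tanE q r x : L q -> good (q, r) -> L x -> ball q r x ->
    tangent f x = tangent f q.
  move=> Lq [_ _ gq] Lx xr; have [r' [r'0 _ gx]] := goodP x Lx.
  apply: tangent_locally_constant r'0 xr _ gq gx.
  by rewrite (LS _ Lx).2 (LS _ Lq).2.
(* Leaf points are grouped by a property [P]: [W P] is the open union of the good balls centred at
   leaf points satisfying [P]. *)
pose W (P : set 'rV[R]_n) :=
  \bigcup_(z in [set z | [/\ L z.1, P z.1 & good z]]) ball z.1 z.2.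
have oW P : open (W P) by apply: bigcup_open => z _; exact: ball_open.
have inW (P : set 'rV[R]_n) q : L q -> P q -> W P q.
  move=> Lq Pq; have [r gr] := goodP q Lq.
  by exists (q, r) => //=; apply: ballxx; case: gr.
pose same := [set q | tangent f q = tangent f p].
have Lsame : L `&` W same = L.
  apply: (@component_connected _ _ p).
  - by exists p; split => //; exact: inW.
  - by exists (W same).
  - exists (~` W (~` same)); first exact: open_closedC.
    apply/seteqP; split => x [Lx Wx]; split => //.
      move=> [[q r] /= [Lq nq gq] xr]; apply: nq.
      case: Wx => [[q' r'] /= [Lq' sq' gq'] xr'].
      by rewrite /same/= -(tanE q r x)// (tanE q' r' x).
    apply: (inW same x) => //; apply: contrapT => nx; apply: Wx; exact: inW.
exists (gradient f p), (dot (gradient f p) p), (W same).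
split; [exact: g0|exact: oW|].
have HE x : dot (gradient f p) x = dot (gradient f p) p <-> tangent f p x.
  rewrite /tangent/= dotB; split => [->|/eqP]; first by rewrite subrr.
  by rewrite subr_eq0 => /eqP.
apply/seteqP; split => x.
  move=> Lx; have : (L `&` W same) x by rewrite Lsame.
  move=> [_ Wx]; split => //; apply/HE.
  have [[q r] /= [Lq sq gq] xr] := Wx.
  rewrite -sq -(tanE q r x)//.
  by rewrite /tangent/= subrr -(scale0r 0) dotZ mul0r.
(* Conversely, a point of the hyperplane in a good ball around a leaf point [q] is joined to [q] by
   a segment in the ball and in the hyperplane, hence in the level set; so it lies in the same
   component. *)
move=> [/HE + [[q r] /= [Lq sq gq] xr]].
rewrite -sq => Tx.
apply: (connected_component_trans Lq); apply: segment_component => t t01.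
have [r0 rD rT] := gq.
have br : ball q r (q + t *: (x - q)).
  by apply: ball_segment => //; exact: ballxx.
split; first exact: rD.
rewrite -(LS _ Lq).2; apply/(rT _ br).
by rewrite /tangent/= addrC addKr dotZ Tx mulr0.
Qed.

(** * Geodesics *)

Lemma is_derive_affine (R : realType) (n : nat) (p v : 'rV[R]_n) (t : R) :
  is_derive t 1 (fun s : R => p + s *: v) v.
Proof.
have d := is_diffD (is_diff_cst p t) (is_diff_scalel t v).
have dd : differentiable (fun s : R => p + s *: v) t.
  by case: d.
split; first exact: diff_derivable.
rewrite deriveE//.
by have -> := @diff_val _ _ _ _ _ _ _ d; rewrite /= add0r scale1r.
Qed.

Lemma derive1_line (R : realType) (n : nat) (p v : 'rV[R]_n) (t : R) :
  derive1 (fun s : R => p + s *: v) t = v.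
Proof. by rewrite derive1E (@derive_val _ _ _ _ _ _ _ (is_derive_affine p v t)). Qed.

Lemma near_line (R : realType) (n : nat) (D : set 'rV[R]_n) (p v : 'rV[R]_n)
    (t : R) : open D -> D (p + t *: v) -> \forall s \near t, D (p + s *: v).
Proof.
move=> oD Dt; have dc := @ex_derive _ _ _ _ _ _ _ (is_derive_affine p v t).
have cc : {for t, continuous (fun s : R => p + s *: v)}.
  by move/derivable1_diffP/differentiable_continuous: dc.
by apply: cc; exact: open_nbhs_nbhs.
Qed.

Lemma derive0_const (R : realType) (h : R -> R) (a b : R) :
  (forall t, a < t < b -> is_derive t 1 h 0) ->
  forall s t, a < s < b -> a < t < b -> h s = h t.
Proof.
move=> h0 s t; wlog st : s t / s <= t => [W|] sI tI.
  have [/W|/ltW ts] := leP s t; first exact.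
  by apply/esym; exact: W.
have sub u : s <= u <= t -> is_derive u 1 h 0.
  move: sI tI => /andP[a_s _] /andP[_ tb] /andP[su ut]; apply: h0.
  by rewrite (lt_le_trans a_s su) (le_lt_trans ut tb).
have [||u _ /eqP] := @MVT_segment R h (cst 0) s t st.
- by move=> u; rewrite in_itv/= => /andP[su ut]; apply: sub; rewrite !ltW.
- apply: derivable_within_continuous => u; rewrite in_itv/= => /sub hu.
  exact: ex_derive.
- by rewrite mul0r subr_eq0 => /eqP.
Qed.

Lemma is_derive_dot (R : realType) (n : nat) (a : 'rV[R]_n) (c : R -> 'rV[R]_n)
    (t : R) : derivable c t 1 ->
  is_derive t 1 (fun s => dot a (c s)) (dot a (derive1 c t)).
Proof.
move=> dc.
have -> : (fun s => dot a (c s)) = \sum_(i < n) (fun s => a 0 i * c s 0 i).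
  by apply/funext => s; rewrite fct_sumE.
apply: is_derive_sum => i.
have di : is_derive t 1 (fun s => c s 0 i) (derive1 c t 0 i).
  rewrite derive1E (derive_mx dc) mxE; apply: derivableP.
  by move/derivable_mxP: dc; exact.
exact: is_derive_eq.
Qed.

(** Since f is constant near q on the hyperplane with normal [a], ker a lies in ker df. A vector v
    in ker df with [dot a v] nonzero would, together with ker a, span the whole space and force df =
    0. *)
Lemma hyperplane_normal (R : realType) (n : nat) (D V : set 'rV[R]_n)
    (f : 'rV[R]_n -> R) (a q v : 'rV[R]_n) :
  smooth_on D f -> D q -> gradient f q != 0 -> open V -> V q ->
  (forall x, V x -> dot a x = dot a q -> f x = f q) ->
  dot (gradient f q) v = 0 -> dot a v = 0.
Proof.
move=> fS Dq g0 oV Vq fa gv; apply: contrapT => /eqP av.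
have ker w : dot a w = 0 -> dot (gradient f q) w = 0.
  move=> aw; have Dq' : D (q + 0 *: w) by rewrite scale0r addr0.
  have dw := is_derive_smooth_line fS Dq'.
  have := @derive_val _ _ _ _ _ _ _ dw.
  rewrite scale0r addr0 => <-; rewrite (@near_eq_derive _ _ _ _ (cst (f q)))//.
    exact: derive_cst.
  have Vq' : V (q + 0 *: w) by rewrite scale0r addr0.
  apply: filterS (near_line oV Vq') => s.
  by move/fa; apply; rewrite dotD dotZ aw mulr0 addr0.
move/eqP: g0; apply; apply/rowP => i; rewrite -dot_delta mxE.
(* [w] is the projection of e_i onto ker a along v, so df(e_i) = df(w) = 0. *)
pose w := delta_mx 0 i - (dot a (delta_mx 0 i) / dot a v) *: v.
have : dot (gradient f q) w = 0 by apply: ker; rewrite dotB dotZ divfK// subrr.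
by rewrite dotB dotZ gv mulr0 subr0.
Qed.

(** With zero Christoffel symbols the geodesic equation is c'' = 0. Hence [dot a] of the velocity is
    constant, and it is 0 at the moment of tangency, so c keeps its value of [dot a]; by continuity
    it also remains in [V] for nearby times. *)
Lemma open_piece_totally_geodesic (R : realType) (n : nat) (U D : set 'rV[R]_n)
    (nab : linear_connection U) (f : 'rV[R]_n -> R) (p : 'rV[R]_n) :
  (forall k i j p, U p -> christoffel nab k i j p = 0) ->
  smooth_on D f -> (forall q, D q -> gradient f q != 0) ->
  open_piece_of_hyperplane (leaf D f p) -> totally_geodesic nab f (leaf D f p).
Proof.
move=> chr0 fS g0 [a [b [V [a0 oV LE]]]] t1 t2 t0 c t012 geo Lc dfc.
have leafS x : leaf D f p x -> D x /\ f x = f p by move/connected_component_sub.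
have [Dc fc] := leafS _ Lc.
have [ac Vc] : dot a (c t0) = b /\ V (c t0) by move: Lc; rewrite LE.
have av : dot a (derive1 c t0) = 0.
  apply: (hyperplane_normal fS Dc (g0 _ Dc) oV Vc) => [x Vx ax|].
    have : leaf D f p x by rewrite LE; split => //; rewrite -ac -ax.
    by move=> /leafS[_ ->].
  by rewrite -derive_gradient//; exact: smooth_on_differentiable fS Dc.
have ddot t : t1 < t < t2 -> is_derive t 1 (fun s => dot a (derive1 c s)) 0.
  move=> /geo[Ut _ dc2 eq].
  have -> : 0 = dot a (derive1 (derive1 c) t).
    rewrite /dot big1// => k _; have := eq k; rewrite big1 => [|i _].
      by rewrite addr0 => ->; rewrite mulr0.
    by rewrite big1// => j _; rewrite chr0// !mul0r.
  exact: is_derive_dot.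
have dot1 t : t1 < t < t2 -> is_derive t 1 (fun s => dot a (c s)) 0.
  move=> tI; rewrite -av (derive0_const ddot t012 tI).
  by apply: is_derive_dot; have [] := geo t tI.
have ct0 : {for t0, continuous c}.
  by have [_ /derivable1_diffP/differentiable_continuous] := geo t0 t012.
have nV : \forall t \near t0, V (c t) by apply: ct0; exact: open_nbhs_nbhs.
have nI : \forall t \near t0, t1 < t < t2.
  have : nbhs t0 `]t1, t2[%classic.
    by apply: open_nbhs_nbhs; split; [exact: interval_open|rewrite /= in_itv].
  by apply: filterS => t; rewrite /= in_itv.
apply: filterS2 nV nI => t Vt tI.
by rewrite LE; split => //; rewrite /= -ac; exact: (derive0_const dot1).
Qed.

Lemma line_geodesic (R : realType) (n : nat) (U : set 'rV[R]_n)
    (nab : linear_connection U) (p v : 'rV[R]_n) (a b : R) :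
  (forall k i j p, U p -> christoffel nab k i j p = 0) ->
  (forall t, a < t < b -> U (p + t *: v)) ->
  geodesic nab a b (fun t => p + t *: v).
Proof.
move=> chr0 Uc t tI.
have dcE : derive1 (fun t : R => p + t *: v) = cst v.
  by apply/funext => s; exact: derive1_line.
have Ut := Uc t tI; split => //.
- exact: (@ex_derive _ _ _ _ _ _ _ (is_derive_affine p v t)).
- by rewrite dcE; exact: derivable_cst.
- move=> k; rewrite dcE derive1_cst mxE add0r big1// => i _.
  by rewrite big1// => j _; rewrite chr0// !mul0r.
Qed.

Lemma dot_bivector (R : realType) (n : nat) (X : 'rV[R]_n) (a b : R)
    (s t : 'I_n) :
  dot X (a *: delta_mx 0 s - b *: delta_mx 0 t) = a * X 0 s - b * X 0 t.
Proof. by rewrite dotB !dotZ !dot_delta. Qed.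

(** For g the Hessian of f, a = f_t and b = f_s, the right side is, up to symmetry of second
    derivatives, [Flex f s t]. *)
Lemma quadratic_bivector (R : realType) (n : nat) (a b : R) (s t : 'I_n)
    (g : 'I_n -> 'I_n -> R) :
  let v : 'rV[R]_n := a *: delta_mx 0 s - b *: delta_mx 0 t in
  \sum_i v 0 i * dot (\row_k g i k) v =
  a * (a * g s s - b * g s t) - b * (a * g t s - b * g t t).
Proof.
move=> v; pose H : 'rV[R]_n := \row_i dot (\row_k g i k) v.
transitivity (dot H v); last by rewrite dot_bivector !mxE !dot_bivector !mxE.
by apply: eq_bigr => i _; rewrite [H 0 i]mxE mulrC.
Qed.

Lemma totally_geodesic_Flex (R : realType) (n : nat) (U D : set 'rV[R]_n)
    (nab : linear_connection U) (f : 'rV[R]_n -> R) (p : 'rV[R]_n) (s t : 'I_n) :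
  (forall k i j p, U p -> christoffel nab k i j p = 0) ->
  open D -> D `<=` U -> smooth_on D f -> D p ->
  totally_geodesic nab f (leaf D f p) -> Flex f s t p = 0.
Proof.
move=> chr0 oD DU fS Dp tg.
(* This vector is in ker df at [p], so the line through [p] with velocity [v] is a geodesic tangent
   to the leaf. *)
pose v : 'rV[R]_n := partial t f p *: delta_mx 0 s - partial s f p *: delta_mx 0 t.
have gv : dot (gradient f p) v = 0.
  rewrite dot_bivector !mxE; by move: (@partial R n) => d; rewrite mulrC subrr.
have p0 : p + 0 *: v = p by rewrite scale0r addr0.
have nD : \forall t \near (0 : R), D (p + t *: v).
  by apply: near_line => //; rewrite p0.
have /nbhs_ballP[e /= e0 De] := nD.
have {}De (u : R) : - e < u < e -> D (p + u *: v).
  by move=> ue; apply: De; rewrite -ball_normE/= sub0r normrN ltr_norml.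
have e00 : - e < 0 < e by rewrite oppr_lt0 e0.
have := tg (- e) e 0 _ e00 (line_geodesic chr0 (fun u ue => DU _ (De u ue))).
rewrite p0 => /(_ (connected_component_refl (conj Dp erefl))).
rewrite derive1_line derive_gradient; last exact: smooth_on_differentiable fS Dp.
move=> /(_ gv) nL.
have nf : \forall t \near (0 : R), f (p + t *: v) = f p.
  by apply: filterS nL => x /connected_component_sub[].
(* By [near_join], f is constant around every parameter close to 0, so its first derivative along
   the line vanishes near 0 and can be differentiated once more at 0. *)
have nu : \forall t \near (0 : R), dot (gradient f (p + t *: v)) v = 0.
  apply: filterS2 nD (near_join nf) => u Du fu.
  rewrite -(@derive_val _ _ _ _ _ _ _ (is_derive_smooth_line fS Du)).
  by rewrite (@near_eq_derive _ _ _ _ (cst (f p)))// derive_cst.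
have D0 : D (p + 0 *: v) by rewrite p0.
have du := is_derive_gradient_line fS D0.
have := @derive_val _ _ _ _ _ _ _ du.
rewrite (@near_eq_derive _ _ _ _ (cst 0)) // derive_cst p0 => sum0.
have := etrans sum0 (quadratic_bivector (partial t f p) (partial s f p) s t
  (fun i k => partial k (partial i f) p)).
have := partialC s t oD fS Dp; rewrite /Flex.
by move: (@partial R n) => d -> E; rewrite [RHS]E; ring.
Qed.

Theorem theorem7 (R : realType) (n d : nat) (U D : set 'rV[R]_n)
  (nab : linear_connection U) (f : 'I_d -> 'rV[R]_n -> R)
  (n_ge2 : (2 <= n)%N) (d_gt : (n.+1 <= d)%N)
  (U_open : open U) (D_open : open D) (D_sub_U : D `<=` U)
  (nab_flat : flat nab) (nab_torsion_free : torsion_free nab)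
  (christoffel0 : forall k i j p, U p -> christoffel nab k i j p = 0)
  (web : is_web D f) :
  (hyperplanar nab D f <->
     forall (alpha : 'I_d) (s t : 'I_n), (s < t)%N ->
       forall p, D p -> Flex (f alpha) s t p = 0) /\
  (hyperplanar nab D f <->
     forall (alpha : 'I_d) (p : 'rV[R]_n), D p ->
       open_piece_of_hyperplane (leaf D (f alpha) p)).
Proof.
have [fS fg0 _] := web.
(* Both equivalences follow from a cycle of three implications: totally geodesic leaves, vanishing
   of [Flex], leaves that are open pieces of hyperplanes, and back. *)
have HF : hyperplanar nab D f -> forall (alpha : 'I_d) (s t : 'I_n), (s < t)%N ->
    forall p, D p -> Flex (f alpha) s t p = 0.
  move=> hyp alpha s t _ p Dp.
  exact: totally_geodesic_Flex christoffel0 D_open D_sub_U (fS alpha) Dp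
    (hyp alpha p Dp).
have FL : (forall (alpha : 'I_d) (s t : 'I_n), (s < t)%N ->
      forall p, D p -> Flex (f alpha) s t p = 0) ->
    forall (alpha : 'I_d) (p : 'rV[R]_n), D p ->
      open_piece_of_hyperplane (leaf D (f alpha) p).
  move=> F0 alpha p Dp.
  have P0 := polar_eq0 D_open (fS alpha) (Flex_eq0 D_open (fS alpha) (F0 alpha)).
  exact: leaf_open_piece D_open (fS alpha) P0 (fg0 alpha) Dp.
have LH : (forall (alpha : 'I_d) (p : 'rV[R]_n), D p ->
      open_piece_of_hyperplane (leaf D (f alpha) p)) -> hyperplanar nab D f.
  move=> pieces alpha p Dp.
  exact: open_piece_totally_geodesic christoffel0 (fS alpha) (fg0 alpha)
    (pieces alpha p Dp).
split; split => [hyp|H].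
- exact: HF hyp.
- exact: LH (FL H).
- exact: FL (HF hyp).
- exact: LH H.
Qed.
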